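(* Let $n\ge 1$ be an integer, let $K\subset\mathbb{C}$ be a compact set and let $w:K\to[0,\infty)$ be a bounded upper semi-continuous function that is nonzero on at least $n+1$ points of $K$. Let $P_n$ be a monic polynomial of degree $n$ with complex coefficients. Then $P_n$ is a weighted Chebyshev polynomial of degree $n$ on $K$ with respect to $w$ if and only if there exist $m\le2n+1$ (distinct) $w$-extremal points $z_1,\dots,z_m$ of $P_n$ on $K$ and positive numbers $\alpha_1,\dots,\alpha_m$ such that $\sum_{j=1}^m\alpha_j=1$ and for each $q\in\mathbb{P}_{n-1}$, $$\sum_{j=1}^m\alpha_jP_n(z_j)\overline{q(z_j)}=0.$$
   Context: $\mathbb{P}_{n-1}$ is the space of polynomials with complex coefficients of degree at most $n-1$. $\|P\|_{K,w}=\sup_{z\in K}w(z)|P(z)|$. A weighted Chebyshev polynomial of degree $n$ on $K$ with respect to $w$ is a monic polynomial of degree $n$ that minimizes $\|\cdot\|_{K,w}$ among all monic polynomials of degree $n$. A point $z\in K$ is a $w$-extremal point of $P$ on $K$ if $w(z)|P(z)|=\|P\|_{K,w}$. A function $w:K\to[0,\infty)$ is upper semi-continuous if $w(z)\ge\limsup_{K\ni\zeta\to z}w(\zeta)$ for each accumulation point $z$ of $K$. *)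

(* Defs.v *)
From HB Require Import structures.
From mathcomp Require Import all_boot all_order all_algebra.
From mathcomp Require Import all_classical all_reals all_analysis.
From mathcomp Require Import complex.

Set Implicit Arguments.
Unset Strict Implicit.
Unset Printing Implicit Defensive.

Import Order.TTheory GRing.Theory Num.Theory.
Import numFieldNormedType.Exports.

Local Open Scope classical_set_scope.
Local Open Scope ring_scope.
Local Open Scope complex_scope.

(* The field C is R[i] for an arbitrary R : realType, with the topology of its
   modulus (that of R[i] as a numFieldType, made canonical here);
   Normc.normc is the R-valued modulus. A weight on K is given by a function
   on all of R[i], and the notions below only use its values on K. *)
HB.instance Definition _ (R : realType) :=
  PseudoMetricNormedZmod.copy R[i] (R[i] : numFieldType).

Section WeightedChebyshev.
Context {R : realType}.
Implicit Types (K : set R[i]) (w : R[i] -> R) (P : {poly R[i]}) (z : R[i]).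

Definition nonneg_on K w : Prop := forall z, K z -> 0 <= w z.

Definition bounded_weight_on K w : Prop :=
  exists M : R, forall z, K z -> `|w z| <= M.

Definition upper_semicontinuous_on K w : Prop :=
  forall z, K z -> limit_point K z ->
    (limf_esup (fun zeta => (w zeta)%:E) (within K z^') <= (w z)%:E)%E.

(* The supremum is taken in the extended reals, so that it is meaningful
   without assuming K nonempty and w bounded. *)
Definition wnorm K w P : \bar R :=
  ereal_sup [set (w z * Normc.normc P.[z])%:E | z in K].

(* size is the degree plus one *)
Definition monic_of_degree (n : nat) P : Prop :=
  P \is monic /\ size P = n.+1.

Definition weighted_chebyshev (n : nat) K w P : Prop :=
  monic_of_degree n P /\
  forall Q : {poly R[i]}, monic_of_degree n Q ->
    (wnorm K w P <= wnorm K w Q)%E.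

Definition extremal_point K w P z : Prop :=
  K z /\ (w z * Normc.normc P.[z])%:E = wnorm K w P.

End WeightedChebyshev.

(* Main.v *)
Require Import Defs.
From HB Require Import structures.
From mathcomp Require Import all_boot all_order all_algebra.
From mathcomp Require Import all_classical all_reals all_analysis.
From mathcomp Require Import complex ring lra.

Set Implicit Arguments.
Unset Strict Implicit.
Unset Printing Implicit Defensive.

Import Order.TTheory GRing.Theory Num.Theory.
Import numFieldNormedType.Exports.

Local Open Scope classical_set_scope.
Local Open Scope ring_scope.
Local Open Scope complex_scope.

(* If P is orthogonal to P - Q with positive weights at extremal points, then
   |Q| cannot be smaller than |P| at all of them, since
   2 Re (P conj (P - Q)) = |P|^2 - |Q|^2 + |P - Q|^2.
   Conversely (Kolmogorov's criterion), if P is optimal, then for each q of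
   degree < n some extremal point z has Re (P z conj (q z)) <= 0; otherwise
   P - e q would be better for a small e > 0. In terms of the points
   (P z conj (z^k))_(k < n) of R^(2n), z extremal, no linear form is positive on
   all of these points. As they form a compact set, so do the convex
   combinations of 2n + 1 of them, and by Caratheodory's theorem these form a
   convex set; its point of least norm must be 0. *)

(** * Caratheodory's theorem and the scalar product of row vectors *)

(** Induction on the size of the support: subtracting a multiple of a linear relation between the
    vectors of the support makes a coefficient vanish. The last clause is linear independence on the
    support of [b], phrased with families on all of [I] that vanish outside it. *)
Lemma conic_caratheodory (R : realFieldType) (I : finType) (d : nat)
    (f : I -> 'rV[R]_d) (a : I -> R) :
  (forall i, 0 <= a i) ->
  exists b : I -> R, [/\ forall i, 0 <= b i,
    \sum_i b i *: f i = \sum_i a i *: f i &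
    forall u : I -> R, (forall i, b i = 0 -> u i = 0) ->
      \sum_i u i *: f i = 0 -> forall i, u i = 0].
Proof.
have [k] := ubnP #|[pred i | a i != 0]|.
elim: k a => // k IH a ltk a_ge0.
case: (pselect (exists u : I -> R, [/\ forall i, a i = 0 -> u i = 0,
  \sum_i u i *: f i = 0 & exists i, 0 < u i])) => [[u [ua uf [i0 ui0]]]|noU].
  (* t is the largest number such that a - t u is nonnegative. *)
  have [i ui_gt0 imin] := @arg_minP _ _ I i0 (fun i => 0 < u i)
    (fun i => a i / u i) ui0.
  pose t := a i / u i.
  have t_ge0 : 0 <= t by rewrite divr_ge0 ?a_ge0 // ltW.
  have b_ge0 j : 0 <= a j - t * u j.
    have [uj|uj] := ltP 0 (u j); last first.
      by rewrite subr_ge0 (le_trans _ (a_ge0 j)) // mulr_ge0_le0.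
    by rewrite subr_ge0 -ler_pdivlMr // imin.
  have ltb : (#|[pred j | (a j - t * u j)%R != 0%R]| < k)%N.
    rewrite -ltnS (leq_trans _ ltk) // ltnS; apply: proper_card.
    apply/properP; split.
      apply/fintype.subsetP => j; rewrite !inE; apply: contra => /eqP aj.
      by rewrite aj (ua _ aj) mulr0 subr0.
    exists i; rewrite !inE /=.
      by apply/eqP => ai; move: ui_gt0; rewrite (ua _ ai) ltxx.
    by rewrite /t divfK ?subrr ?eqxx // gt_eqF.
  have [b [b0 bE bI]] := IH _ ltb b_ge0.
  exists b; split=> //; rewrite bE.
  under eq_bigr do rewrite scalerBl -scalerA.
  by rewrite big_split /= sumrN -scaler_sumr uf scaler0 subr0.
(* The opposite of a relation is a relation, so a nonzero one can be assumed to have a positive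
   coefficient. *)
exists a; split=> // u ua uf i; apply/eqP; apply: contra_notT noU => ui.
have [ui0|ui0|/eqP] := ltgtP (u i) 0; last by rewrite (negPf ui).
  exists (fun i => - u i); split; last by exists i; rewrite oppr_gt0.
    by move=> j /ua ->; rewrite oppr0.
  by under eq_bigr do rewrite scaleNr; rewrite sumrN uf oppr0.
by exists u; split=> //; exists i.
Qed.

Lemma card_independent_family (F : fieldType) (I : finType) (d : nat)
    (f : I -> 'rV[F]_d) (S : {set I}) :
  (forall u : I -> F, (forall i, i \notin S -> u i = 0) ->
    \sum_i u i *: f i = 0 -> forall i, u i = 0) ->
  (#|S| <= d)%N.
Proof.
move=> indep; pose A := \matrix_(i < #|S|) f (enum_val i).
suff /eqP <- : row_free A by exact: rank_leq_col.
apply: inj_row_free => v vA.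
(* [u] extends the row [v], indexed by the elements of [S], by zero. *)
pose u i := oapp (v 0) 0 [pick k : 'I_#|S| | enum_val k == i].
apply/rowP => k; rewrite mxE.
have uS i : i \notin S -> u i = 0.
  move=> iS; rewrite /u; case: pickP => //= j /eqP ji.
  by rewrite -ji enum_valP in iS.
have uE (j : 'I_#|S|) : u (enum_val j) = v 0 j.
  rewrite /u; case: pickP => [l /eqP /enum_val_inj -> //|/(_ j)].
  by rewrite eqxx.
rewrite -uE; apply: indep => //.
rewrite (bigID (mem S)) /= [X in _ + X]big1 ?addr0 => [|i iS]; last first.
  by rewrite uS // scale0r.
rewrite big_enum_val -[RHS]vA mulmx_sum_row.
by apply: eq_bigr => j _; rewrite uE rowK.
Qed.

(** The nearest point to 0 is sought in the Euclidean sense, whereas the norm carried by row vectors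
    is the maximum norm. *)
Definition dotv (R : pzRingType) (d : nat) (u v : 'rV[R]_d) : R :=
  \sum_j u 0 j * v 0 j.

Lemma dotv_ge0 (R : realDomainType) (d : nat) (u : 'rV[R]_d) : 0 <= dotv u u.
Proof. by apply: sumr_ge0 => j _; rewrite -expr2 sqr_ge0. Qed.

Lemma dotv_eq0 (R : realDomainType) (d : nat) (u : 'rV[R]_d) :
  dotv u u = 0 -> u = 0.
Proof.
move=> /eqP; rewrite psumr_eq0 => [/allP u0|j _]; last first.
  by rewrite -expr2 sqr_ge0.
apply/rowP => j; rewrite mxE; apply/eqP.
by have := u0 j (mem_index_enum j); rewrite mulf_eq0 orbb.
Qed.

Lemma dotvDZ (R : comPzRingType) (d : nat) (u v : 'rV[R]_d) (t : R) :
  dotv (u + t *: v) (u + t *: v) =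
  dotv u u + 2 * t * dotv u v + t ^+ 2 * dotv v v.
Proof.
rewrite /dotv !mulr_sumr -!big_split /=; apply: eq_bigr => j _.
by rewrite !mxE; ring.
Qed.

Lemma dotvBr (R : comPzRingType) (d : nat) (u v w : 'rV[R]_d) :
  dotv u (v - w) = dotv u v - dotv u w.
Proof.
by rewrite /dotv -sumrB; apply: eq_bigr => j _; rewrite !mxE mulrBr.
Qed.

Lemma dotv_min_segment (R : realFieldType) (d : nat) (y v : 'rV[R]_d) :
  (forall t, 0 <= t <= 1 ->
     dotv y y <= dotv (y + t *: (v - y)) (y + t *: (v - y))) ->
  dotv y y <= dotv y v.
Proof.
move=> ymin; rewrite -subr_ge0 -dotvBr; set c := dotv y (v - y).
rewrite leNgt; apply/negP => c0.
set D := dotv (v - y) (v - y); have D0 : 0 <= D by exact: dotv_ge0.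
have s0 : 0 < D - c by lra.
(* For this t, the increment 2 t c + t^2 D equals t c (1 + t) < 0; moreover D >= 0 gives t <= 1. *)
have [t [t0 t1 tE]] : exists t, [/\ 0 < t, t <= 1 & t * (D - c) = - c].
  exists (- c / (D - c)); split; last by rewrite divfK // gt_eqF.
    by rewrite divr_gt0 // oppr_gt0.
  by rewrite ler_pdivrMr // mul1r; lra.
have := ymin t; rewrite dotvDZ -/c -/D (ltW t0) t1 => /(_ isT).
nra.
Qed.

(** Prepending a coordinate 1 to each vector turns affine relations into linear ones in dimension d
    + 1. Two equal vectors in the support would be dependent, whence the injectivity, which later
    makes the extremal points distinct. *)
Lemma convex_caratheodory (R : realFieldType) (I : finType) (d : nat)
    (v : I -> 'rV[R]_d) (a : I -> R) :
  (forall i, 0 <= a i) ->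
  exists b : I -> R, [/\ forall i, 0 <= b i, \sum_i b i = \sum_i a i,
    \sum_i b i *: v i = \sum_i a i *: v i,
    (#|[pred i | b i != 0%R]| <= d.+1)%N &
    {in [pred i | b i != 0] &, injective v}].
Proof.
move=> a_ge0; pose f i : 'rV[R]_(1 + d) := row_mx (const_mx 1) (v i).
have fE c : \sum_i c i *: f i =
    row_mx (const_mx (\sum_i c i)) (\sum_i c i *: v i).
  apply: (big_ind3 (fun x y z => x = row_mx (const_mx y) z)).
  - by rewrite raddf0 row_mx0.
  - by move=> x1 y1 z1 x2 y2 z2 -> ->; rewrite add_row_mx raddfD.
  - by move=> i _; rewrite scale_row_mx scalemx_const mulr1.
have [b [b_ge0 bE indep]] := conic_caratheodory f a_ge0.
move: bE; rewrite !fE => /eq_row_mx[/rowP/(_ 0)]; rewrite !mxE => bE1 bE2.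
exists b; split=> //.
  have := @card_independent_family _ _ _ f [set i | b i != 0]%SET.
  rewrite cardsE => -> // u uS; apply: indep => i bi.
  by apply: uS; rewrite inE bi eqxx.
move=> i j; rewrite !inE => bi bj vij; apply/eqP; apply: contraTT isT => nij.
pose u k : R := (k == i)%:R - (k == j)%:R.
have delta l : \sum_k (k == l)%:R *: f k = f l.
  rewrite (bigD1 l) //= eqxx scale1r big1 ?addr0 // => k /negPf ->.
  by rewrite scale0r.
have uf : \sum_k u k *: f k = 0.
  under eq_bigr do rewrite scalerBl.
  by rewrite sumrB !delta /f vij subrr.
have u0 k : b k = 0 -> u k = 0.
  move=> bk; rewrite /u; case: eqVneq => [ki|_].
    by rewrite -ki bk eqxx in bi.
  by case: eqVneq => [kj|_]; [rewrite -kj bk eqxx in bj|rewrite subrr].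
by have /eqP := indep u u0 uf i; rewrite /u eqxx (negPf nij) subr0 oner_eq0.
Qed.

(** * Convex combinations of points of a compact set *)

Lemma continuous_rV (T : topologicalType) (R : realType) (d : nat)
    (f : T -> 'rV[R]_d) :
  (forall j, continuous (fun x => f x 0 j)) -> continuous f.
Proof.
move=> fc x.
have fE : f = fun y => \sum_j f y 0 j *: (delta_mx 0 j : 'rV[R]_d).
  by apply/funext => y; exact: row_sum_delta.
rewrite fE; apply: continuous_big; first exact: add_continuous.
by move=> j _ y; apply: cvgZr_tmp; exact: fc.
Qed.

Lemma continuous_dotv (R : realType) (d : nat) :
  continuous (fun y : 'rV[R]_d => dotv y y).
Proof.
apply: continuous_big; first exact: add_continuous.
move=> j _ y; have cj := @coord_continuous R 1 d 0 j y.
by have := continuousM cj cj.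
Qed.

Section ConvexHull.
Context {R : realType} {d : nat}.
Implicit Type V : set 'rV[R]_d.

Let weighted k := prod_topology (fun _ : 'I_k => (R * 'rV[R]_d)%type).
Let comb k (Z : weighted k) : 'rV[R]_d := \sum_i (Z i).1 *: (Z i).2.
(** The elements are families of weights and points; the convex combinations are their images under
    [comb]. In the product topology this is a closed part of a product of compact sets, hence
    compact by Tychonoff's theorem. *)
Let hull k V : set (weighted k) :=
  [set Z | forall i, (`[0, 1]%classic `*` V) (Z i)] `&`
  [set Z | \sum_i (Z i).1 = 1].

Let weightedP k (i : 'I_k) : continuous (fun Z : weighted k => Z i).
Proof. exact: proj_continuous. Qed.

Let weight_continuous k (i : 'I_k) : continuous (fun Z : weighted k => (Z i).1).
Proof.
by move=> Z; apply: (continuous_comp (@weightedP k i Z)); exact: cvg_fst.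
Qed.

Let point_continuous k (i : 'I_k) : continuous (fun Z : weighted k => (Z i).2).
Proof.
by move=> Z; apply: (continuous_comp (@weightedP k i Z)); exact: cvg_snd.
Qed.

Let comb_continuous k : continuous (@comb k).
Proof.
apply: continuous_big; first exact: add_continuous.
move=> i _ Z.
exact: (cvgZ (@weight_continuous k i Z) (@point_continuous k i Z)).
Qed.

Let hull_compact k V : compact V -> compact (@hull k V).
Proof.
move=> cV; apply: compact_closedI.
  apply: (@tychonoff _ (fun _ : 'I_k => (R * 'rV[R]_d)%type)
     (fun _ => (`[0, 1]%classic `*` V))) => _.
  by apply: compact_setX => //; exact: segment_compact.
have -> : [set Z : weighted k | \sum_i (Z i).1 = 1] =
  (fun Z : weighted k => \sum_i (Z i).1) @^-1` [set 1] by [].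
apply: closed_comp; last exact: closed_eq.
move=> Z _; move: Z; apply: continuous_big; first exact: add_continuous.
by move=> i _; exact: weight_continuous.
Qed.

(* Caratheodory's theorem drops one of the k + 1 points involved. *)
Let comb_segment k (V : set 'rV[R]_d) (Z : weighted k) (v : 'rV[R]_d) (t : R) :
  (d < k)%N -> hull V Z -> V v -> 0 <= t <= 1 ->
  exists2 Z' : weighted k, hull V Z' & comb Z' = comb Z + t *: (v - comb Z).
Proof.
move=> dk [ZV Z1] Vv /andP[t0 t1].
(* Index 0 carries [v] with weight t; the others carry the family [Z] with weights scaled by 1 -
   t. *)
pose a (i : 'I_k.+1) := oapp (fun j => (1 - t) * (Z j).1) t (unlift ord0 i).
pose p (i : 'I_k.+1) := oapp (fun j => (Z j).2) v (unlift ord0 i).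
have a_ge0 i : 0 <= a i.
  rewrite /a; case: unliftP => //= j _.
  apply: mulr_ge0; first by rewrite subr_ge0.
  by have [/= + _] := ZV j; rewrite in_itv /= => /andP[].
have a1 : \sum_i a i = 1.
  rewrite big_ord_recl /a unlift_none /=.
  by under eq_bigr do rewrite liftK /=; rewrite -mulr_sumr Z1 mulr1 addrC subrK.
have ap : \sum_i a i *: p i = comb Z + t *: (v - comb Z).
  rewrite big_ord_recl /a /p unlift_none /=.
  under eq_bigr do rewrite liftK /= -scalerA.
  rewrite -scaler_sumr -/(comb Z) scalerBl scale1r scalerBr.
  by rewrite addrCA.
have [b [b_ge0 b1 bp bk _]] := convex_caratheodory p a_ge0.
(* The support has at most d + 1 <= k of the k + 1 indices; dropping a zero weight leaves a family
   of length k. *)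
have [i0 /eqP bi0] : exists i0, b i0 == 0.
  apply/existsP; apply: contraTT bk => /existsPn b0.
  have -> : #|[pred i | b i != 0]| = k.+1.
    by rewrite -[RHS]card_ord; apply: eq_card => i; rewrite !inE b0.
  by rewrite -ltnNge.
exists (fun j => (b (lift i0 j), p (lift i0 j))).
  split=> [j|] /=.
    split=> /=; last first.
      by rewrite /p; case: unliftP => //= l _; have [] := ZV l.
    rewrite in_itv /= b_ge0 -a1 -b1 (bigD1 (lift i0 j)) //= lerDl.
    by apply: sumr_ge0.
  by rewrite -a1 -b1 (bigD1_ord i0) //= bi0 add0r.
by rewrite -ap -bp (bigD1_ord i0) //= bi0 scale0r add0r.
Qed.

(** Let y be the combination of least norm. The hypothesis gives v in V with y.v <= 0, while
    minimality on the segment from y to v gives y.y <= y.v. *)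
Lemma zero_in_convex_hull V :
  compact V -> (forall u, exists2 v, V v & dotv u v <= 0) ->
  exists (m : nat) (v : 'I_m -> 'rV[R]_d) (a : 'I_m -> R),
    [/\ (m <= d.+1)%N, injective v, forall j, V (v j), forall j, 0 < a j &
        \sum_j a j = 1 /\ \sum_j a j *: v j = 0].
Proof.
move=> cV sepV; have [v0 Vv0 _] := sepV 0.
have hull0 : hull (k := d.+1) V !=set0.
  exists (fun i => ((i == ord0)%:R, v0)); split=> /= [i|].
    by split=> //=; rewrite in_itv /=; case: eqP; rewrite ?lexx ?ler01.
  by rewrite big_ord_recl /= big1 ?addr0.
have cont : continuous (fun Z : weighted d.+1 => dotv (comb Z) (comb Z)).
  move=> Z.
  exact: (continuous_comp (@comb_continuous _ Z)
    (@continuous_dotv R d (comb Z))).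
have [Z /set_mem hZ Zmin] := compact_EVT_min hull0 (hull_compact cV)
  (continuous_subspaceT cont).
have combZ : comb Z = 0.
  have [v Vv Zv] := sepV (comb Z).
  apply: dotv_eq0; apply/eqP; rewrite eq_le dotv_ge0 andbT.
  apply: le_trans Zv; apply: dotv_min_segment => t t01.
  have [Z' hZ' <-] := comb_segment (ltnSn d) hZ Vv t01.
  by apply: Zmin; exact/mem_set.
have [ZV Z1] := hZ.
have Z_ge0 i : 0 <= (Z i).1.
  by have [/= + _] := ZV i; rewrite in_itv /= => /andP[].
(* The minimizing family may have zero weights or repeated points; a last reduction, restricted to
   its support, removes both. *)
have [b [b_ge0 b1 bp bk bI]] := convex_caratheodory (fun i => (Z i).2) Z_ge0.
pose S := [pred i | b i != 0].
have bS i : i \notin S -> b i = 0 by rewrite inE negbK => /eqP.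
have bigS (U : nmodType) (F : 'I_d.+1 -> U) : (forall i, b i = 0 -> F i = 0) ->
    \sum_(j < #|S|) F (enum_val j) = \sum_i F i.
  move=> F0; rewrite -(big_enum_val F) [RHS](bigID (mem S)) /=.
  by rewrite [X in _ = _ + X]big1 ?addr0 // => i /bS /F0.
exists #|S|, (fun j => (Z (enum_val j)).2), (fun j => b (enum_val j)).
split=> //.
- by move=> i j /(bI _ _ (enum_valP i) (enum_valP j)); exact: enum_val_inj.
- by move=> j; have [] := ZV (enum_val j).
- by move=> j; rewrite lt_neqAle b_ge0 eq_sym andbT; have := enum_valP j.
- rewrite bigS // b1 Z1; split=> //.
  rewrite (bigS _ (fun i => b i *: (Z i).2)) ?bp // => i ->.
  by rewrite scale0r.
Qed.

End ConvexHull.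

(** * Continuity of complex polynomial expressions *)

Section ComplexContinuity.
Context {R : realType}.
Implicit Types (x y z : R[i]) (p q : {poly R[i]}).
Local Notation normc := (@Normc.normc R).

Let normE z : `|z| = (normc z)%:C. Proof. by []. Qed.

Lemma normc_ge0 z : 0 <= normc z.
Proof. by rewrite -ler0c -normE. Qed.

Lemma sqr_normcE z : normc z ^+ 2 = complex.Re z ^+ 2 + complex.Im z ^+ 2.
Proof.
by case: z => a b; rewrite /normc /= sqr_sqrtr // addr_ge0 ?sqr_ge0.
Qed.

(** The balls of [R[i]] have radii in [R[i]], so a real e enters as [e%:C]. *)
Lemma continuous_lipschitz_normc (f : R[i] -> R) :
  (forall x y, `|f x - f y| <= normc (x - y)) -> continuous f.
Proof.
move=> flip x; apply/(@cvgrPdist_lt _ _ _ (nbhs x)) => e e0.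
have e0c : 0 < e%:C by rewrite ltcR.
have := @nbhsx_ballx _ R[i] x _ e0c.
apply: filterS => y; rewrite -ball_normE /= normE ltcR.
exact: le_lt_trans.
Qed.

Lemma normrRe_le_normc z : `|complex.Re z| <= normc z.
Proof. by rewrite -lecR; exact: normc_ge_Re. Qed.

Lemma normrIm_le_normc z : `|complex.Im z| <= normc z.
Proof.
have -> : normc z = normc (z * 'i).
  by rewrite Normc.normcM /= expr0n /= add0r expr1n sqrtr1 mulr1.
by rewrite -[complex.Im z]opprK -ReiNIm normrN normrRe_le_normc.
Qed.

Lemma continuous_Re : continuous (@complex.Re R : R[i] -> R).
Proof.
apply: continuous_lipschitz_normc => x y.
by rewrite -raddfB; exact: normrRe_le_normc.
Qed.

Lemma continuous_Im : continuous (@complex.Im R : R[i] -> R).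
Proof.
apply: continuous_lipschitz_normc => x y.
by rewrite -raddfB; exact: normrIm_le_normc.
Qed.

Lemma continuous_normc : continuous (normc : R[i] -> R).
Proof.
apply: continuous_lipschitz_normc => x y.
have := le_normcD (x - y) y; have := le_normcD (y - x) x.
by rewrite -[normc (y - x)]normcN opprB !subrK ler_norml; lra.
Qed.

Lemma continuous_horner_complex p : continuous (fun z => p.[z] : R[i]).
Proof.
elim/poly_ind: p => [|p c IH].
  have -> : (fun z => 0.[z]) = (fun=> 0 : R[i]).
    by apply/funext => z; rewrite horner0.
  by move=> z; exact: cst_continuous.
have -> : (fun z => (p * 'X + c%:P).[z]) = (fun z => p.[z] * z + c :> R[i]).
  by apply/funext => z; rewrite !hornerE.
move=> z.
have c1 : {for z, continuous (fun z : R[i] => p.[z] * z)}.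
  exact: (@continuousM R[i] R[i] (fun z => p.[z]) id z (IH z) cvg_id).
by apply: (cvgD c1); exact: cvg_cst.
Qed.

Lemma Re_mulJ x y :
  complex.Re (x * y^*) =
  complex.Re x * complex.Re y + complex.Im x * complex.Im y.
Proof. by case: x y => [a b] [c d] /=; rewrite mulrN opprK. Qed.

Lemma Re_realM (a : R) x : complex.Re (a%:C * x) = a * complex.Re x.
Proof. by case: x => b c /=; rewrite mul0r subr0. Qed.

Lemma Im_realM (a : R) x : complex.Im (a%:C * x) = a * complex.Im x.
Proof. by case: x => b c /=; rewrite mul0r addr0. Qed.

(** Small e serves to perturb an optimal polynomial, and e = 1 to compare two monic ones. *)
Lemma sqr_normcB x y (e : R) :
  normc (x - e%:C * y) ^+ 2 =
  normc x ^+ 2 - 2 * e * complex.Re (x * y^*) + e ^+ 2 * normc y ^+ 2.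
Proof. by rewrite !sqr_normcE; case: x y => [a b] [c d] /=; ring. Qed.

Lemma continuous_Re_mulJ_horner p q :
  continuous (fun z => complex.Re (p.[z] * (q.[z])^*)).
Proof.
have cRe r : continuous (fun z => complex.Re r.[z]).
  move=> z; exact: (continuous_comp (@continuous_horner_complex r z)
    (@continuous_Re r.[z])).
have cIm r : continuous (fun z => complex.Im r.[z]).
  move=> z; exact: (continuous_comp (@continuous_horner_complex r z)
    (@continuous_Im r.[z])).
have -> : (fun z => complex.Re (p.[z] * (q.[z])^*)) = (fun z =>
  complex.Re p.[z] * complex.Re q.[z] + complex.Im p.[z] * complex.Im q.[z]).
  by apply/funext => z; rewrite Re_mulJ.
move=> z; exact: (cvgD (cvgM (cRe p z) (cRe q z)) (cvgM (cIm p z) (cIm q z))).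
Qed.

Lemma continuous_Im_mulJ_horner p q :
  continuous (fun z => complex.Im (p.[z] * (q.[z])^*)).
Proof.
have -> : (fun z => complex.Im (p.[z] * (q.[z])^*)) = (fun z =>
  complex.Re (p.[z] * ('i%C *: q).[z]^*)).
  apply/funext => z; rewrite hornerZ.
  by case: p.[z] q.[z] => [a b] [c d] /=; ring.
exact: continuous_Re_mulJ_horner.
Qed.

End ComplexContinuity.

(** * Upper semi-continuity and maxima *)

Lemma usc_compact_max (T : topologicalType) (R : realType) (K : set T)
    (u : T -> R) :
  compact K -> K !=set0 ->
  (forall z c, K z -> u z < c -> \forall x \near z, K x -> u x < c) ->
  exists2 z, K z & forall x, K x -> u x <= u z.
Proof.
move=> /compact_near_coveringP/near_covering_withinP cK [z0 Kz0] uscu.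
(* Otherwise the sets [set x | K x /\ u y <= u x], for y in K, generate a
   filter along which u eventually exceeds its value at each point of K. *)
apply: contrapT => nomax.
have above x : K x -> exists2 y, K y & u x < u y.
  move=> Kx; apply: contrapT => nab; apply: nomax; exists x => // y Ky.
  by rewrite leNgt; apply/negP => uxy; apply: nab; exists y.
pose F : set_system T :=
  [set A | exists2 y, K y & forall x, K x -> u y <= u x -> A x].
have FF : Filter F.
  split; first by exists z0.
    move=> A B [a Ka aA] [b Kb bB].
    have [ab|ba] := leP (u a) (u b).
      by exists b => // x Kx bx; split; [exact/aA/(le_trans ab)|exact: bB].
    by exists a => // x Kx ax; split; [exact: aA|exact/bB/(le_trans (ltW ba))].
  by move=> A B AB [a Ka aA]; exists a => // x Kx /(aA _ Kx)/AB.
have cover x : K x -> \forall x' \near x & i \near F, K x' -> u x' < u i.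
  move=> Kx; have [y Ky xy] := above x Kx.
  exists ([set x' | K x' -> u x' < u y], [set i | u y <= u i]).
    by split; [exact: uscu|exists y].
  by move=> [x' i] /= [x'y yi] Kx'; exact: lt_le_trans (x'y Kx') yi.
(* By compactness, for i eventually along [F], all values on K are below [u i]; taking i = x = y is
   absurd. *)
have [y Ky yP] := cK _ F (fun i x' => u x' < u i) FF cover.
by have := yP y Ky (lexx _) y Ky; rewrite ltxx.
Qed.

Section Weight.
Context {R : realType}.
Implicit Types (K : set R[i]) (w g : R[i] -> R) (z : R[i]).

(** Near an isolated point of K there is no other point of K. At a limit point, the upper limit
    bounds w on a punctured neighbourhood, and z itself is covered by [w z < c]. *)
Lemma upper_semicontinuous_near K w z (c : R) :
  upper_semicontinuous_on K w -> K z -> w z < c ->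
  \forall x \near z, K x -> w x < c.
Proof.
move=> uscw Kz wc; have [lz|] := pselect (limit_point K z); last first.
  rewrite not_limit_pointE => -[U zU UK].
  by apply: filterS zU => x Ux Kx; rewrite (UK x) //; split.
have : (limf_esup (fun x => (w x)%:E) (within K z^') < c%:E)%E.
  by apply: le_lt_trans (uscw z Kz lz) _; rewrite lte_fin.
rewrite limf_esupE => /ereal_inf_lt[_ [A KA <-] supA].
have : nbhs z [set x | x != z -> K x -> A x] by exact: KA.
apply: filterS => x xA Kx; have [->//|xz] := eqVneq x z.
rewrite -lte_fin; apply: le_lt_trans supA.
by apply: ereal_sup_ubound; exists x => //; exact: xA.
Qed.

Lemma upper_semicontinuous_mul_near K w g z (c : R) :
  nonneg_on K w -> upper_semicontinuous_on K w ->
  (forall x, 0 <= g x) -> continuous g -> K z -> w z * g z < c ->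
  \forall x \near z, K x -> w x * g x < c.
Proof.
move=> w_ge0 uscw g_ge0 cg Kz wgc.
have wz := w_ge0 z Kz; have gz := g_ge0 z.
have [e e0 ec] : exists2 e, 0 < e & (w z + e) * (g z + e) <= c.
  have s0 : 0 < w z + g z + 1 by lra.
  (* As e <= 1, (w + e)(g + e) <= w g + e (w + g + 1) <= c, with w and g taken at z. *)
  pose e := Num.min 1 ((c - w z * g z) / (w z + g z + 1)).
  have e0 : 0 < e by rewrite lt_min ltr01 divr_gt0 // subr_gt0.
  have e1 : e <= 1 by rewrite ge_min lexx.
  have es : e * (w z + g z + 1) <= c - w z * g z.
    by rewrite -ler_pdivlMr // ge_min lexx orbT.
  by exists e => //; nra.
have we : w z < w z + e by lra.
have ge : g z < g z + e by lra.
near=> x => Kx; apply: lt_le_trans ec.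
have wx : K x -> w x < w z + e by near: x; exact: upper_semicontinuous_near.
have gx : g x < g z + e by near: x; exact: cvgr_lt (cg z) _ ge.
by apply: ltr_pM => //; [exact: w_ge0|exact: wx].
Unshelve. all: by end_near. Qed.

End Weight.

(** * Extremal points and Kolmogorov's criterion *)

Section Chebyshev.
Context {R : realType}.
Context {K : set R[i]} {w : R[i] -> R}.
Context (cK : compact K) (w_ge0 : nonneg_on K w)
  (uscw : upper_semicontinuous_on K w).
Implicit Types (P Q q : {poly R[i]}) (z : R[i]).
Local Notation normc := (@Normc.normc R).

Lemma continuous_normc_horner Q : continuous (fun z => normc Q.[z]).
Proof.
move=> z; exact: (continuous_comp (@continuous_horner_complex R Q z)
  (@continuous_normc R Q.[z])).
Qed.

Lemma wnorm_near Q z (c : R) : K z -> w z * normc Q.[z] < c ->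
  \forall x \near z, K x -> w x * normc Q.[x] < c.
Proof.
apply: (upper_semicontinuous_mul_near w_ge0 uscw) => [x|].
  exact: normc_ge0.
exact: continuous_normc_horner.
Qed.

Lemma wnorm_attained Q : K !=set0 ->
  exists2 z, K z & wnorm K w Q = (w z * normc Q.[z])%:E.
Proof.
move=> K0; have [z Kz zmax] := usc_compact_max cK K0 (@wnorm_near Q).
exists z => //; apply/le_anti/andP; split.
  by apply: ge_ereal_sup => _ [x Kx <-]; rewrite lee_fin zmax.
by apply: ereal_sup_ubound; exists z.
Qed.

(** A point of K where w |P| is below its maximum has, by upper semi-continuity, a neighbourhood
    without extremal points; so these form a closed subset of K. *)
Lemma extremal_compact P : compact (extremal_point K w P).
Proof.
apply: (subclosed_compact _ cK); last by move=> z [].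
move=> z clz.
have Kz : K z.
  apply: (compact_closed (@norm_hausdorff _ R[i]) cK) => U zU.
  by have [x [[Kx _] Ux]] := clz U zU; exists x.
split=> //; apply/le_anti/andP; split.
  by apply: ereal_sup_ubound; exists z.
rewrite leNgt; apply/negP => ltz.
have [z0 Kz0 Nz0] := wnorm_attained P (ex_intro _ z Kz).
move: ltz; rewrite Nz0 lte_fin => ltz.
have [x [[Kx]]] := clz _ (wnorm_near Kz ltz).
by rewrite Nz0 => -[->] /(_ Kx); rewrite ltxx.
Qed.

(** A polynomial of degree n cannot vanish at n + 1 distinct points. Hence the norm of P is
    positive, which settles the points where w vanishes in the perturbation argument. *)
Lemma exists_weighted_value_gt0 n P :
  (`I_n.+1 #<= [set z | K z /\ w z != 0])%card ->
  size P = n.+1 -> exists2 z, K z & 0 < w z * normc P.[z].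
Proof.
move=> /pcard_leP[f] sP; apply: contrapT => noz.
have P0 : P != 0 by rewrite -size_poly_eq0 sP.
have fS (i : 'I_n.+1) : K (f i) /\ w (f i) != 0.
  by apply: (@funS _ _ _ _ f); rewrite /= ltn_ord.
have rP : all (root P) [seq f (val i) | i <- enum 'I_n.+1].
  apply/allP => _ /mapP[i _ ->]; have [Kf wf] := fS i.
  apply: contra_notT noz => rf; exists (f i) => //.
  apply: mulr_gt0; first by rewrite lt_neqAle eq_sym wf w_ge0.
  rewrite lt_neqAle normc_ge0 andbT eq_sym; apply: contra rf.
  by move=> /eqP/Normc.eq0_normc/eqP.
suff /(max_poly_roots P0 rP) : uniq [seq f (val i) | i <- enum 'I_n.+1].
  by rewrite size_map size_enum_ord sP ltnn.
rewrite map_inj_uniq ?enum_uniq // => i j fij.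
by apply: val_inj; apply: (@inj _ _ _ f) fij; rewrite inE /= ltn_ord.
Qed.

(* If Re (P conj q) > 0 held at all the extremal points, then P - e q would
   have a smaller norm than P for small e > 0: near the extremal points because
   |P - e q|^2 = |P|^2 - 2 e Re (P conj q) + e^2 |q|^2, and elsewhere because
   w |P| stays below its maximum. *)
Lemma weighted_chebyshev_Re_le0 n P q :
  bounded_weight_on K w ->
  (`I_n.+1 #<= [set z | K z /\ w z != 0])%card ->
  weighted_chebyshev n K w P -> (size q <= n)%N ->
  exists2 z, extremal_point K w P z & complex.Re (P.[z] * (q.[z])^*) <= 0.
Proof.
move=> [B0 wB0] cardK [[monP sP] minP] sq.
have [z0 Kz0 z0_gt0] := exists_weighted_value_gt0 cardK sP.
have K0 : K !=set0 by exists z0.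
apply: contrapT => noz.
have posz z : extremal_point K w P z -> 0 < complex.Re (P.[z] * (q.[z])^*).
  by move=> zE; rewrite ltNge; apply/negP => zle; apply: noz; exists z.
have [zN KzN wN] := wnorm_attained P K0.
set N := w zN * normc P.[zN] in wN.
have leN z : K z -> w z * normc P.[z] <= N.
  by move=> Kz; rewrite -lee_fin -wN; apply: ereal_sup_ubound; exists z.
have N_gt0 : 0 < N by exact: lt_le_trans (leN _ Kz0).
have Bw z : K z -> w z <= B0.
  by move=> Kz; apply: le_trans (wB0 z Kz); exact: ler_norm.
have B0_ge0 : 0 <= B0 by apply: le_trans (Bw _ Kz0); exact: w_ge0.
have QE z (e : R) : (P - e%:C *: q).[z] = P.[z] - e%:C * q.[z].
  by rewrite !hornerE.
(* The admissible e depends on z here; compactness of K then provides one e for all of K. *)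
have cover z : K z -> \forall x \near z & e \near 0^'+, K x ->
    w x * normc (P - e%:C *: q).[x] < N.
  move=> Kz; pose M := normc q.[z] + 1.
  have M_gt0 : 0 < M by rewrite ltr_wpDl ?normc_ge0.
  have nearM : \forall x \near z, normc q.[x] < M.
    by apply: cvgr_lt (@continuous_normc_horner q z) _ _; rewrite ltrDl.
  have [zE|zE] := pselect (extremal_point K w P z).
    pose h x := complex.Re (P.[x] * (q.[x])^*).
    have hz : 0 < h z by exact: posz.
    near=> x e => Kx; rewrite QE.
    have e0 : 0 < e by near: e; exact: nbhs_right_gt.
    (* Then e^2 |q x|^2 <= e^2 M^2 < e h(z) < 2 e h(x), so the linear term wins. *)
    have eM : e < h z / M ^+ 2.
      by near: e; apply: nbhs_right_lt; rewrite divr_gt0 // exprn_gt0.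
    have hx : h z / 2 < h x.
      near: x; apply: cvgr_gt (@continuous_Re_mulJ_horner R P q z) _ _.
      by rewrite -/(h z); lra.
    have qM : normc q.[x] < M by near: x.
    have ltP : normc (P.[x] - e%:C * q.[x]) < normc P.[x].
      rewrite -(@ltr_pXn2r _ 2) ?nnegrE ?normc_ge0 // sqr_normcB -/(h x).
      have q2 : normc q.[x] ^+ 2 <= M ^+ 2.
        by rewrite ler_pXn2r ?nnegrE ?normc_ge0 // ltW.
      have : e * M ^+ 2 < h z by rewrite -ltr_pdivlMr // exprn_gt0.
      by nra.
    have [wx|] := eqVneq (w x) 0; first by rewrite wx mul0r.
    move=> wx; apply: lt_le_trans (leN x Kx).
    by rewrite ltr_pM2l // lt_neqAle eq_sym wx w_ge0.
  have ltz : w z * normc P.[z] < N.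
    rewrite lt_neqAle leN // andbT; apply: contra_notN zE => /eqP zN'.
    by split=> //; rewrite zN' wN.
  pose c := (w z * normc P.[z] + N) / 2.
  near=> x e => Kx; rewrite QE.
  have e0 : 0 < e by near: e; exact: nbhs_right_gt.
  (* The perturbation adds at most e B0 M < N - c to a value below c; the 1 keeps the denominator
     positive if B0 = 0. *)
  have eM : e < (N - c) / (B0 * M + 1).
    near: e; apply: nbhs_right_lt; rewrite divr_gt0 //.
      by rewrite /c; lra.
    by rewrite ltr_wpDl // mulr_ge0 // ltW.
  have qM : normc q.[x] < M by near: x.
  have wc : K x -> w x * normc P.[x] < c.
    by near: x; apply: wnorm_near => //; rewrite /c; lra.
  have wx := w_ge0 Kx.
  have tri : normc (P.[x] - e%:C * q.[x]) <= normc P.[x] + e * normc q.[x].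
    apply: le_trans (le_normcD _ _) _; rewrite normcN Normc.normcM lerD2l.
    by rewrite /= expr0n /= addr0 sqrtr_sqr gtr0_norm.
  have := ler_wpM2l wx tri; have := wc Kx; have := Bw x Kx.
  have : e * (B0 * M + 1) < N - c.
    by rewrite -ltr_pdivlMr // ltr_wpDl // mulr_ge0 // ltW.
  have : w x * normc q.[x] <= B0 * M.
    by apply: ler_pM; rewrite ?normc_ge0 ?Bw // ltW.
  by nra.
have /compact_near_coveringP/near_covering_withinP/(_ _ _ _ _ cover) := cK.
move=> /filter_ex[e /= eQ].
have monQ : monic_of_degree n (P - e%:C *: q).
  have sQ : (size (- (e%:C *: q)) < size P)%N.
    by rewrite size_polyN sP ltnS (leq_trans (size_scale_leq _ _)).
  split; last by rewrite size_polyDl.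
  by rewrite monicE lead_coefDl // -monicE.
have [x Kx xQ] := wnorm_attained (P - e%:C *: q) K0.
have := minP _ monQ; rewrite wN xQ lee_fin leNgt.
by rewrite eQ.
Unshelve. all: by end_near. Qed.

End Chebyshev.

(** * Optimality and orthogonality *)

Section Orthogonality.
Context {R : realType}.
Context {K : set R[i]} {w : R[i] -> R} {n : nat} {P : {poly R[i]}}.
Local Notation normc := (@Normc.normc R).

Lemma size_monicB (Q : {poly R[i]}) :
  monic_of_degree n P -> monic_of_degree n Q -> (size (P - Q)%R <= n)%N.
Proof.
move=> [/monicP P1 sP] [/monicP Q1 sQ]; apply/leq_sizeP => j.
rewrite leq_eqVlt coefB => /orP[/eqP <-|nj].
  by move: P1 Q1; rewrite /lead_coef sP sQ /= => -> ->; rewrite subrr.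
by rewrite !nth_default ?subrr // ?sP ?sQ.
Qed.

Lemma orthogonal_weighted_chebyshev (m : nat) (z : 'I_m -> R[i])
    (alpha : 'I_m -> R) :
  monic_of_degree n P -> nonneg_on K w ->
  (forall j, extremal_point K w P (z j)) -> (forall j, 0 < alpha j) ->
  \sum_(j < m) alpha j = 1 ->
  (forall q : {poly R[i]}, (size q <= n)%N ->
     \sum_(j < m) (alpha j)%:C * (P.[z j] * (q.[z j])^*) = 0) ->
  weighted_chebyshev n K w P.
Proof.
move=> monP w_ge0 zE alpha_gt0 alpha1 ortho; split=> // Q monQ.
(* One such index suffices, since w |P| at [z j] is already the norm of P. *)
have [j PQ] : exists j, normc P.[z j] <= normc Q.[z j].
  apply: contrapT => noj.
  have Re_gt0 j : 0 < complex.Re (P.[z j] * ((P - Q).[z j])^*).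
    have ltQP : normc Q.[z j] < normc P.[z j].
      by rewrite ltNge; apply/negP => PQ; apply: noj; exists j.
    have := sqr_normcB P.[z j] (P - Q).[z j] 1.
    rewrite mul1r {1}hornerD hornerN opprD opprK addrA subrr add0r.
    have := sqr_ge0 (normc (P - Q).[z j]).
    have : normc Q.[z j] ^+ 2 < normc P.[z j] ^+ 2.
      by rewrite ltr_pXn2r ?nnegrE ?normc_ge0.
    by lra.
  have /(congr1 (@complex.Re R)) := ortho _ (size_monicB monP monQ).
  rewrite raddf_sum /= => /psumr_eq0P all0.
  (* All terms would be both zero and positive, so there would be no index at all, contradicting
     that the weights sum to 1. *)
  move: alpha1; rewrite big1 => [/esym/eqP|j _]; first by rewrite oner_eq0.
  have := all0 _ j isT; rewrite Re_realM => sum0; apply: contraTeq isT => _.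
  have := mulr_gt0 (alpha_gt0 j) (Re_gt0 j); rewrite sum0 ?ltxx // => l _.
  by rewrite Re_realM mulr_ge0 // ltW.
have [Kz <-] := zE j.
apply: (@le_trans _ _ (w (z j) * normc Q.[z j])%:E).
  by rewrite lee_fin ler_wpM2l // w_ge0.
by apply: ereal_sup_ubound; exists (z j).
Qed.

Let moments (z : R[i]) : 'rV[R]_(n + n) :=
  row_mx (\row_(k < n) complex.Re (P.[z] * (z ^+ k)^*))
         (\row_(k < n) complex.Im (P.[z] * (z ^+ k)^*)).

Let moments_continuous : continuous moments.
Proof.
apply: continuous_rV => j; case: (split_ordP j) => k ->.
  have -> : (fun z => moments z 0 (lshift n k)) =
      (fun z => complex.Re (P.[z] * ('X^k).[z]^*)).
    by apply/funext => z; rewrite row_mxEl mxE hornerXn.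
  exact: continuous_Re_mulJ_horner.
have -> : (fun z => moments z 0 (rshift n k)) =
    (fun z => complex.Im (P.[z] * ('X^k).[z]^*)).
  by apply/funext => z; rewrite row_mxEr mxE hornerXn.
exact: continuous_Im_mulJ_horner.
Qed.

(** Real linear forms on the moments are the maps Re (P conj q): the form u corresponds to the q
    with coefficients u_k + i u_(n+k), as Re (x conj c) = Re c Re x + Im c Im x. *)
Let dotv_moments (u : 'rV[R]_(n + n)) : exists2 q : {poly R[i]},
  (size q <= n)%N &
  forall z, dotv u (moments z) = complex.Re (P.[z] * (q.[z])^*).
Proof.
pose cu (i : 'I_n) : R[i] := u 0 (lshift n i) +i* u 0 (rshift n i).
pose q := \poly_(k < n) oapp cu 0 (insub k).
exists q; first exact: size_poly.
move=> z; rewrite horner_poly raddf_sum mulr_sumr raddf_sum /=.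
rewrite /dotv big_split_ord /= -big_split /=; apply: eq_bigr => k _.
rewrite row_mxEl row_mxEr !mxE valK /= /cu rmorphM.
by case: P.[z] (z ^+ k) => [a b] [c d] /=; ring.
Qed.

(** The coordinates of the vanishing sum express orthogonality to the monomials z^k, k < n; it
    extends to q by conjugate linearity. *)
Lemma moments_orthogonal (m : nat) (z : 'I_m -> R[i]) (alpha : 'I_m -> R) :
  \sum_j alpha j *: moments (z j) = 0 ->
  forall q : {poly R[i]}, (size q <= n)%N ->
    \sum_(j < m) (alpha j)%:C * (P.[z j] * (q.[z j])^*) = 0.
Proof.
move=> mom0 q sq.
have mom (k : 'I_n) : \sum_j (alpha j)%:C * (P.[z j] * (z j ^+ k)^*) = 0.
  apply/eqP; rewrite eq_complex; apply/andP; split; apply/eqP.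
    rewrite raddf_sum; have /rowP/(_ (lshift n k)) := mom0.
    rewrite summxE mxE => momk; rewrite -[RHS]momk; apply: eq_bigr => j _.
    by rewrite /= Re_realM mxE row_mxEl mxE.
  rewrite raddf_sum; have /rowP/(_ (rshift n k)) := mom0.
  rewrite summxE mxE => momk; rewrite -[RHS]momk; apply: eq_bigr => j _.
  by rewrite /= Im_realM mxE row_mxEr mxE.
under eq_bigr do rewrite (horner_coef_wide _ sq) raddf_sum !mulr_sumr.
rewrite exchange_big big1 // => k _ /=.
transitivity ((q`_k)^* * \sum_j (alpha j)%:C * (P.[z j] * (z j ^+ k)^*)).
  by rewrite mulr_sumr; apply: eq_bigr => j _; rewrite rmorphM /=; ring.
by rewrite mom mulr0.
Qed.

Lemma weighted_chebyshev_orthogonal :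
  compact K -> nonneg_on K w -> bounded_weight_on K w ->
  upper_semicontinuous_on K w ->
  (`I_n.+1 #<= [set z | K z /\ w z != 0])%card ->
  weighted_chebyshev n K w P ->
  exists (m : nat) (z : 'I_m -> R[i]) (alpha : 'I_m -> R),
    [/\ (m <= 2 * n + 1)%N, injective z,
        forall j, extremal_point K w P (z j), forall j, 0 < alpha j &
        \sum_(j < m) alpha j = 1] /\
    forall q : {poly R[i]}, (size q <= n)%N ->
      \sum_(j < m) (alpha j)%:C * (P.[z j] * (q.[z j])^*) = 0.
Proof.
move=> cK w_ge0 wB uscw cardK chebP.
have cV : compact (moments @` extremal_point K w P).
  apply: continuous_compact; last exact: extremal_compact.
  exact/continuous_subspaceT/moments_continuous.
have sepV u : exists2 v, (moments @` extremal_point K w P) v & dotv u v <= 0.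
  have [q sq qE] := dotv_moments u.
  have [z zE zq] := weighted_chebyshev_Re_le0 cK w_ge0 uscw wB cardK chebP sq.
  by exists (moments z); [exists z|rewrite qE].
have [m [v [alpha [mn v_inj vV alpha_gt0 [alpha1 alphav]]]]] :=
  zero_in_convex_hull cV sepV.
(* One extremal point is chosen for each moment vector; distinct vectors force distinct points. *)
have /choice[z zE] : forall j, exists x,
    extremal_point K w P x /\ moments x = v j.
  by move=> j; have [x xE xv] := vV j; exists x.
exists m, z, alpha; split; [split=> //|].
- by rewrite addn1 mul2n -addnn.
- by move=> i j zij; apply: v_inj; rewrite -(zE i).2 -(zE j).2 zij.
- by move=> j; exact: (zE j).1.
- apply: moments_orthogonal; rewrite -[RHS]alphav.
  by apply: eq_bigr => j _; rewrite (zE j).2.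
Qed.

End Orthogonality.

Theorem theorem8 (R : realType) (n : nat) (K : set R[i]) (w : R[i] -> R)
    (P : {poly R[i]}) :
  (1 <= n)%N ->
  compact K ->
  nonneg_on K w ->
  bounded_weight_on K w ->
  upper_semicontinuous_on K w ->
  (`I_n.+1 #<= [set z | K z /\ w z != 0])%card ->
  monic_of_degree n P ->
  weighted_chebyshev n K w P <->
  exists (m : nat) (z : 'I_m -> R[i]) (alpha : 'I_m -> R),
    [/\ (m <= 2 * n + 1)%N,
        injective z,
        (forall j, extremal_point K w P (z j)),
        (forall j, 0 < alpha j) &
        \sum_(j < m) alpha j = 1] /\
    forall q : {poly R[i]}, (size q <= n)%N ->
      \sum_(j < m) (alpha j)%:C * (P.[z j] * (q.[z j])^*) = 0.
Proof.
move=> _ cK w_ge0 wB uscw cardK monP.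
split; first exact: weighted_chebyshev_orthogonal.
move=> [m [z [alpha [[_ _ zE alpha_gt0 alpha1] ortho]]]].
exact: orthogonal_weighted_chebyshev ortho.
Qed.
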